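(* Let $S$ be a proper connected Lie subgroup of the solvable part $AN$ of the Iwasawa decomposition associated with the complex hyperbolic space $\mathbb{C}H^n$, where $AN$ carries the left-invariant metric making it isometric to $\mathbb{C}H^n$. Assume that $S$ is a Ricci soliton with the induced metric. If its nilradical $L$ is non-flat with the induced metric, then $L$ is a minimal submanifold of $N$.
   Context: A Riemannian manifold $(M,g)$ is a Ricci soliton if $\mathrm{Ric}=cg+\mathcal{L}_Xg$ for some $c\in\mathbb{R}$ and some smooth vector field $X$. $\mathbb{C}H^n$ is the complex hyperbolic space of constant holomorphic sectional curvature $-1$. $AN$ is the connected (simply connected) solvable subgroup of $SU(1,n)$ with Lie algebra $\mathfrak{a}\oplus\mathfrak{n}$, and $N$ is its connected nilpotent subgroup with Lie algebra $\mathfrak{n}=\mathfrak{g}_\alpha\oplus\mathfrak{g}_{2\alpha}$, with the induced metric. Concretely, $\mathfrak{a}\oplus\mathfrak{n}=\mathbb{R}B\oplus\mathfrak{g}_\alpha\oplus\mathbb{R}Z$ (orthogonal sum), with $\mathfrak{a}=\mathbb{R}B$, $\mathfrak{g}_{2\alpha}=\mathbb{R}Z$, $B,Z$ unit vectors, $J$ the orthogonal complex structure with $JB=Z$, $J\mathfrak{g}_\alpha=\mathfrak{g}_\alpha\cong\mathbb{C}^{n-1}$, and for $U,V\in\mathfrak{g}_\alpha$: $[B,U]=\tfrac12U$, $[U,V]=\langle JU,V\rangle Z$, $[B,Z]=Z$, $[Z,U]=0$. The nilradical $L$ of $S$ is the connected Lie subgroup whose Lie algebra is the nilradical (largest nilpotent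 ideal) of the Lie algebra of $S$. *)

(* Defs.v *)
From HB Require Import structures.
From mathcomp Require Import all_boot all_order all_algebra.
From mathcomp Require Import all_classical all_reals all_analysis.
From mathcomp Require Import ring lra.
Set Implicit Arguments.
Unset Strict Implicit.
Unset Printing Implicit Defensive.
Import Order.TTheory GRing.Theory Num.Theory numFieldNormedType.Exports.
Local Open Scope classical_set_scope.
Local Open Scope ring_scope.

Section SolvableModel.
Variables (R : realType) (n : nat).

(* g_alpha = C^(n-1), written as (real part, imaginary part). *)
Definition galpha : Type := ('rV[R]_n.-1 * 'rV[R]_n.-1)%type.

(* The metric Lie algebra a + n = R B + g_alpha + R Z: the triple (b, U, z)
   stands for b B + U + z Z. *)
Definition an : Type := (R^o * galpha * R^o)%type.

Implicit Types (x y w : an) (U V : galpha).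

Definition Jalpha U : galpha := (- U.2, U.1).

Definition dotalpha U V : R :=
  \sum_(i < n.-1) (U.1 0 i * V.1 0 i + U.2 0 i * V.2 0 i).

Definition dot x y : R :=
  x.1.1 * y.1.1 + dotalpha x.1.2 y.1.2 + x.2 * y.2.

(* [B, U] = U/2, [B, Z] = Z, [U, V] = <J U, V> Z, [Z, U] = 0. *)
Definition bracket x y : an :=
  (0, (x.1.1 / 2) *: y.1.2 - (y.1.1 / 2) *: x.1.2,
   x.1.1 * y.2 - y.1.1 * x.2 + dotalpha (Jalpha x.1.2) y.1.2).

(* The simply connected Lie group AN, in the global chart
   (b, U, z) |-> exp (U + z Z) exp (b B); the exponentials on the right are
   multiplied with the Campbell-Hausdorff formula on N and
   Ad (exp (b B)) = e^(b/2) on g_alpha, e^b on R Z.  The chart sends 0 to the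
   identity, and its differential there is the identity of [an]. *)
Definition AN : Type := an.

Definition mulAN (p q : AN) : AN :=
  (p.1.1 + q.1.1,
   p.1.2 + expR (p.1.1 / 2) *: q.1.2,
   p.2 + expR p.1.1 * q.2
     + dotalpha (Jalpha p.1.2) (expR (p.1.1 / 2) *: q.1.2) / 2).

Definition oneAN : AN := 0.

Definition invAN (p : AN) : AN :=
  (- p.1.1, - (expR (- p.1.1 / 2) *: p.1.2), - (expR (- p.1.1) * p.2)).

Definition expm1_div (b : R) : R := if b == 0 then 1 else (expR b - 1) / b.

(* The Lie group exponential map: t |-> expAN (t x) is the one-parameter
   subgroup with initial velocity x (see expAND and is_derive_expAN). *)
Definition expAN x : AN :=
  (x.1.1, expm1_div (x.1.1 / 2) *: x.1.2, expm1_div x.1.1 * x.2).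

Definition is_subgroup (H : set AN) : Prop :=
  [/\ H oneAN, (forall p q, H p -> H q -> H (mulAN p q))
    & (forall p, H p -> H (invAN p))].

(* A connected Lie subgroup, given by its Lie algebra. *)
Record lieSubgroup := LieSubgroup {
  lie_alg : {vspace an};
  lie_algP : forall x y,
    x \in lie_alg -> y \in lie_alg -> bracket x y \in lie_alg }.

Definition carrier (S : lieSubgroup) : set AN :=
  smallest is_subgroup (expAN @` [set x | x \in lie_alg S]).

Definition n_alg : {vspace an} := lker (linfun (fst \o fst : an -> R^o)).

Lemma n_algE x : (x \in n_alg) = (x.1.1 == 0).
Proof. by rewrite memv_ker lfunE. Qed.

Lemma n_alg_bracket x y : x \in n_alg -> y \in n_alg -> bracket x y \in n_alg.
Proof. by move=> _ _; rewrite n_algE. Qed.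

Definition N : lieSubgroup := LieSubgroup n_alg_bracket.

(* Nilradical *)

Definition comm_space (s t : {vspace an}) : {vspace an} :=
  <<[seq bracket x y | x <- vbasis s, y <- vbasis t]>>%VS.

Definition lower_central (s : {vspace an}) (k : nat) : {vspace an} :=
  iter k (comm_space s) s.

Definition nilpotent_alg (s : {vspace an}) : Prop :=
  exists k, lower_central s k = 0%VS.

Definition nilpotent_ideal (s l : {vspace an}) : Prop :=
  [/\ (l <= s)%VS,
      (forall x y, x \in s -> y \in l -> bracket x y \in l)
    & nilpotent_alg l].

Definition is_nilradical (S L : lieSubgroup) : Prop :=
  nilpotent_ideal (lie_alg S) (lie_alg L) /\
  (forall l, nilpotent_ideal (lie_alg S) l -> (l <= lie_alg L)%VS).

(* Left-invariant Riemannian geometry of a connected Lie subgroup with the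
   induced metric.  Left-invariant tensors are given by their values on
   left-invariant vector fields, i.e. on the Lie algebra. *)

(* The vector of s representing the linear form phi on s (see rieszP). *)
Definition riesz (s : {vspace an}) (phi : an -> R) : an :=
  xget 0 [set v | v \in s /\ forall w, w \in s -> dot v w = phi w].

Definition orth_proj (s : {vspace an}) (v : an) : an := riesz s (dot v).

(* Levi-Civita connection of S, by the Koszul formula (see nabla_torsion and
   nabla_metric). *)
Definition nabla (S : lieSubgroup) x y : an :=
  riesz (lie_alg S) (fun w =>
    (dot (bracket x y) w - dot (bracket y w) x + dot (bracket w x) y) / 2).

Definition curvature (S : lieSubgroup) x y w : an :=
  nabla S x (nabla S y w) - nabla S y (nabla S x w)
    - nabla S (bracket x y) w.

Definition flat (S : lieSubgroup) : Prop :=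
  forall x y w, x \in lie_alg S -> y \in lie_alg S -> w \in lie_alg S ->
    curvature S x y w = 0.

Definition trace_on (s : {vspace an}) (f : an -> an) : R :=
  \sum_(i < \dim s) coord (vbasis s) i (f (vbasis s)`_i).

Definition Ric (S : lieSubgroup) x y : R :=
  trace_on (lie_alg S) (fun w => curvature S w x y).

(* Vector fields on S, in the left trivialization TS = S x Lie(S): a field is
   a function on S with values in Lie(S), constant iff it is left-invariant. *)

Definition vderiv (F : AN -> an) (v : an) (p : AN) : an :=
  'D_1 (fun t : R => F (mulAN p (expAN (t *: v)))) 0.

(* F : S -> an is of class C^k; the left-invariant fields form a global frame
   of TS.  The values of F outside S are irrelevant. *)
Fixpoint classC (S : lieSubgroup) (k : nat) (F : AN -> an) : Prop :=
  {within carrier S, continuous F} /\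
  if k is k'.+1 then
    forall v, v \in lie_alg S ->
      (forall p, carrier S p ->
         derivable (fun t : R => F (mulAN p (expAN (t *: v)))) 0 1) /\
      classC S k' (vderiv F v)
  else True.

Definition smooth_vfield (S : lieSubgroup) (X : AN -> an) : Prop :=
  (forall p, carrier S p -> X p \in lie_alg S) /\ (forall k, classC S k X).

Definition vbracket (X Y : AN -> an) (p : AN) : an :=
  vderiv Y (X p) p - vderiv X (Y p) p + bracket (X p) (Y p).

(* (L_X g)(Y, W) = X <Y, W> - <[X, Y], W> - <Y, [X, W]> *)
Definition lie_metric (X Y W : AN -> an) (p : AN) : R :=
  'D_1 (fun t : R => let q := mulAN p (expAN (t *: X p)) in
                     dot (Y q) (W q)) 0
  - dot (vbracket X Y p) (W p) - dot (Y p) (vbracket X W p).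

Definition ricci_soliton (S : lieSubgroup) : Prop :=
  exists (c : R) (X : AN -> an), smooth_vfield S X /\
    forall Y W : AN -> an, smooth_vfield S Y -> smooth_vfield S W ->
    forall p, carrier S p ->
      Ric S (Y p) (W p) = c * dot (Y p) (W p) + lie_metric X Y W p.

(* Extrinsic geometry of L in M *)

Definition second_form (M L : lieSubgroup) x y : an :=
  nabla M x y - orth_proj (lie_alg L) (nabla M x y).

Definition orthonormal_basis (s : {vspace an}) (e : seq an) : Prop :=
  basis_of s e /\
  forall i j, (i < size e)%N -> (j < size e)%N ->
    dot e`_i e`_j = (i == j)%:R.

(* By left-invariance the mean curvature vector need only be computed at the
   identity. *)
Definition minimal_submanifold (M L : lieSubgroup) : Prop :=
  carrier L `<=` carrier M /\
  forall e, orthonormal_basis (lie_alg L) e ->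
    \sum_(x <- e) second_form M L x x = 0.

End SolvableModel.

(* Consistency facts: AN is a group, expAN gives its one-parameter subgroups,
   linear forms are represented in every subspace, and nabla is the torsion-free
   metric connection. *)
Section Facts.
Variables (R : realType) (n : nat).
Local Notation an := (an R n).
Implicit Types (x y w : an) (U V : galpha R n).

Lemma dotalphaC U V : dotalpha U V = dotalpha V U.
Proof. by apply: eq_bigr => i _; rewrite mulrC [X in _ + X]mulrC. Qed.

Lemma dotalphaDZl (a : R) U U' V :
  dotalpha (a *: U + U') V = a * dotalpha U V + dotalpha U' V.
Proof.
rewrite /dotalpha big_distrr -big_split /=; apply: eq_bigr => i _.
by rewrite !mxE; ring.
Qed.

Lemma JalphaDZ (a : R) U U' :
  Jalpha (a *: U + U') = a *: Jalpha U + Jalpha U'.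
Proof.
congr pair; rewrite -[LHS]/(- (a *: U.2 + U'.2)) -[RHS]/(a *: - U.2 - U'.2).
by rewrite opprD scalerN.
Qed.

Lemma dotalphaJ U V : dotalpha (Jalpha U) V = - dotalpha (Jalpha V) U.
Proof.
rewrite /dotalpha -sumrN; apply: eq_bigr => i _; rewrite !mxE; ring.
Qed.

Lemma dotalphaDZr (a : R) U V V' :
  dotalpha U (a *: V + V') = a * dotalpha U V + dotalpha U V'.
Proof. by rewrite dotalphaC dotalphaDZl !(dotalphaC U). Qed.

Lemma dotalphaZl (a : R) U V : dotalpha (a *: U) V = a * dotalpha U V.
Proof.
rewrite -[a *: U]addr0 dotalphaDZl.
suff -> : dotalpha 0 V = 0 by rewrite addr0.
by rewrite /dotalpha big1// => i _; rewrite !mxE !mul0r addr0.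
Qed.

Lemma dotalphaZr (a : R) U V : dotalpha U (a *: V) = a * dotalpha U V.
Proof. by rewrite dotalphaC dotalphaZl dotalphaC. Qed.

Lemma dotalphaDl U U' V : dotalpha (U + U') V = dotalpha U V + dotalpha U' V.
Proof. by have := dotalphaDZl 1 U U' V; rewrite scale1r mul1r. Qed.

Lemma dotalphaDr U V V' : dotalpha U (V + V') = dotalpha U V + dotalpha U V'.
Proof. by rewrite dotalphaC dotalphaDl !(dotalphaC U). Qed.

Lemma JalphaD U V : Jalpha (U + V) = Jalpha U + Jalpha V.
Proof. by have := JalphaDZ 1 U V; rewrite !scale1r. Qed.

Lemma JalphaZ (a : R) U : Jalpha (a *: U) = a *: Jalpha U.
Proof. by congr pair; rewrite -[RHS]/(a *: - U.2) scalerN. Qed.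

Lemma dotalphaJJ U : dotalpha (Jalpha U) U = 0.
Proof. by have := dotalphaJ U U; lra. Qed.

Lemma an_eq x y : x.1.1 = y.1.1 -> x.1.2 = y.1.2 -> x.2 = y.2 -> x = y.
Proof. by case: x y => [[a U] z] [[b V] v] /= -> -> ->. Qed.

Lemma mulANA : associative (@mulAN R n).
Proof.
move=> p q r; apply: an_eq => /=.
- by rewrite addrA.
- by rewrite mulrDl expRD scalerDr addrA scalerA.
- rewrite mulrDl !expRD !JalphaD !JalphaZ !(dotalphaDr, dotalphaDl, dotalphaZl, dotalphaZr).
  have -> : expR p.1.1 = expR (p.1.1/2) * expR (p.1.1/2).
    by rewrite -expRD; congr expR; lra.
  by field.
Qed.

Lemma mul1AN : left_id (@oneAN R n) (@mulAN R n).
Proof.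
move=> p; apply: an_eq => /=; rewrite ?mul0r ?expR0 ?scale1r ?add0r ?mul1r//.
rewrite (_ : Jalpha 0 = 0 *: 0 :> galpha R n) ?dotalphaZl ?mul0r ?addr0//.
by rewrite scale0r /Jalpha /=; congr pair; rewrite oppr0.
Qed.

Lemma mulVAN : left_inverse (@oneAN R n) (@invAN R n) (@mulAN R n).
Proof.
move=> p; apply: an_eq => /=; rewrite ?addNr//.
rewrite -[- (_ *: _)]scaleN1r !JalphaZ !(dotalphaZl, dotalphaZr) dotalphaJJ; ring.
Qed.

Lemma expm1_divM (b : R) : expm1_div b * b = expR b - 1.
Proof.
rewrite /expm1_div; case: eqP => [->|/eqP b0]; first by rewrite expR0 mulr0 subrr.
by rewrite divfK.
Qed.

Lemma expm1_divD (b s t : R) : (s + t) * expm1_div ((s + t) * b) =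
  s * expm1_div (s * b) + expR (s * b) * (t * expm1_div (t * b)).
Proof.
have [->|b0] := eqVneq b 0; first by rewrite !mulr0 /expm1_div eqxx expR0; ring.
apply: (mulIf b0).
have e (c : R) : c * (expm1_div (c * b) * b) = expR (c * b) - 1.
  by rewrite -expm1_divM; ring.
rewrite -mulrA e mulrDl expRD.
transitivity (s * (expm1_div (s * b) * b)
  + expR (s * b) * (t * (expm1_div (t * b) * b))); last by ring.
by rewrite !e; ring.
Qed.

Lemma expAND x (s t : R) :
  expAN ((s + t) *: x) = mulAN (expAN (s *: x)) (expAN (t *: x)).
Proof.
apply: an_eq => /=.
- by rewrite scalerDl.
- rewrite !scalerA -scalerDl; congr (_ *: _).
  have := expm1_divD (x.1.1 / 2) s t.
  rewrite -[s *: x.1.1]/(s * _) -[t *: x.1.1]/(t * _).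
  rewrite -[(s + t) *: x.1.1]/((s + t) * _) !mulrA => e.
  by rewrite mulrC e; ring.
- rewrite !JalphaZ !(dotalphaZl, dotalphaZr) dotalphaJJ.
  have e := expm1_divD x.1.1 s t.
  rewrite -[s *: x.1.1]/(s * _) -[t *: x.1.1]/(t * _).
  rewrite -[(s + t) *: x.1.1]/((s + t) * _).
  rewrite !mulr0 mul0r addr0 -[(s + t) *: _]/((s + t) * _).
  rewrite -[s *: x.2]/(s * _) -[t *: x.2]/(t * _).
  transitivity (((s + t) * expm1_div ((s + t) * x.1.1)) * x.2); first by ring.
  by rewrite e; ring.
Qed.
Lemma an_lin (a : R) x y :
  ((a *: x + y).1.1 = a * x.1.1 + y.1.1) *
  ((a *: x + y).1.2 = a *: x.1.2 + y.1.2) *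
  ((a *: x + y).2 = a * x.2 + y.2).
Proof. by []. Qed.

Lemma dotC x y : dot x y = dot y x.
Proof. by rewrite /dot dotalphaC; ring. Qed.

Lemma dotDZl (a : R) x y w : dot (a *: x + y) w = a * dot x w + dot y w.
Proof.
by rewrite /dot !an_lin dotalphaDZl; ring.
Qed.

Lemma dotDZr (a : R) x y w : dot w (a *: x + y) = a * dot w x + dot w y.
Proof. by rewrite dotC dotDZl !(dotC w). Qed.

Lemma dotBl x y w : dot (x - y) w = dot x w - dot y w.
Proof. by have := dotDZl (-1) y x w; rewrite scaleN1r addrC => ->; ring. Qed.

Lemma dotalpha_ge0 U : 0 <= dotalpha U U.
Proof. by apply: sumr_ge0 => i _; rewrite addr_ge0 // -expr2 sqr_ge0. Qed.

Lemma dot_eq0 x : dot x x = 0 -> x = 0.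
Proof.
have := dotalpha_ge0 x.1.2; have := sqr_ge0 x.1.1; have := sqr_ge0 x.2.
rewrite !expr2 /dot => h1 h2 h3 h.
have {}h3 : dotalpha x.1.2 x.1.2 = 0 by lra.
apply: an_eq => /=.
- by apply/eqP; rewrite -(orbb (_ == 0)) -mulf_eq0; apply/eqP; lra.
- have h4 i : x.1.2.1 0 i = 0 /\ x.1.2.2 0 i = 0.
    move: h3 => /eqP; rewrite psumr_eq0; last first.
      by move=> j _; rewrite addr_ge0 // -expr2 sqr_ge0.
    move=> /allP/(_ i); rewrite mem_index_enum => /(_ isT) /=.
    rewrite paddr_eq0 -?expr2 ?sqr_ge0// !sqrf_eq0.
    by move=> /andP[/eqP -> /eqP ->].
  rewrite [LHS]surjective_pairing; congr pair; apply/rowP => i.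
  + by rewrite (h4 i).1 mxE.
  + by rewrite (h4 i).2 mxE.
- by apply/eqP; rewrite -(orbb (_ == 0)) -mulf_eq0; apply/eqP; lra.
Qed.

Lemma bracketDZl (a : R) x y w :
  bracket (a *: x + y) w = a *: bracket x w + bracket y w.
Proof.
apply: an_eq; rewrite an_lin /bracket [LHS]/= ?an_lin /=.
- by rewrite mulr0 addr0.
- rewrite scalerBr scalerDr !scalerA opprD mulrDl scalerDl addrACA.
  rewrite -[a *: x.1.1]/(a * x.1.1) (mulrC (w.1.1 / 2)) !mulrA //.
- by rewrite -[a *: x.2]/(a * x.2) -[a *: x.1.1]/(a * x.1.1) JalphaDZ dotalphaDZl; ring.
Qed.

Lemma bracketN x y : bracket x y = - bracket y x.
Proof.
apply: an_eq => /=.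
- by rewrite oppr0.
- by rewrite opprB.
- by rewrite [X in _ + X]dotalphaJ -[RHS]/(- (_ + _)); ring.
Qed.

Lemma dotZl (a : R) x w : dot (a *: x) w = a * dot x w.
Proof.
have d0 : dot 0 w = 0.
  by have := dotDZl 1 0 0 w; rewrite scaler0 addr0 mul1r; lra.
by rewrite -[a *: x]addr0 dotDZl d0 addr0.
Qed.

Lemma dotNl x w : dot (- x) w = - dot x w.
Proof. by rewrite -scaleN1r dotZl mulN1r. Qed.

Lemma riesz_uniq (s : {vspace an}) u v : u \in s -> v \in s ->
  (forall w, w \in s -> dot u w = dot v w) -> u = v.
Proof.
move=> us vs uv; apply/eqP; rewrite -subr_eq0; apply/eqP/dot_eq0.
by rewrite dotBl uv ?subrr// rpredB.
Qed.

Lemma rieszP (s : {vspace an}) (phi : an -> R) :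
  (forall a u v, phi (a *: u + v) = a * phi u + phi v) ->
  riesz s phi \in s /\ forall w, w \in s -> dot (riesz s phi) w = phi w.
Proof.
move=> phiL; rewrite /riesz; case: xgetP => [v _ //|none]; exfalso.
pose T (v : an) : 'rV[R]_(\dim s) := \row_i dot v (vbasis s)`_i.
have TL : linear T by move=> a u v; apply/rowP => i; rewrite !mxE dotDZl.
pose f := linfun (HB.pack T (GRing.isLinear.Build _ _ _ _ T TL) : {linear an -> 'rV[R]_(\dim s)}).
have fE v : f v = T v by rewrite lfunE.
have phi0 : phi 0 = 0.
  by have := phiL 1 0 0; rewrite scaler0 addr0 mul1r; lra.
have dot0 (v : an) : dot v 0 = 0.
  by have := dotDZr 1 0 0 v; rewrite scaler0 addr0 mul1r; lra.
have decomp (v : an) : (forall i : 'I_(\dim s), dot v (vbasis s)`_i = phi (vbasis s)`_i) ->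
    forall w, w \in s -> dot v w = phi w.
  move=> h w /coord_vbasis ->.
  elim/big_ind : _ => [|a b ha hb|i _]; first by rewrite dot0.
    have := phiL 1 a b; rewrite scale1r => ->.
    by have := dotDZr 1 a b v; rewrite scale1r => ->; rewrite ha hb.
  by rewrite -[_ *: _]addr0 dotDZr phiL h dot0 phi0.
have inj : (s :&: lker f)%VS = 0%VS.
  apply/eqP; rewrite -subv0; apply/subvP => v /memv_capP[vs].
  rewrite memv_ker fE => /eqP Tv; rewrite memv0; apply/eqP.
  apply: dot_eq0; rewrite {2}(coord_vbasis vs).
  elim/big_ind : _ => [|a b ha hb|i _]; first by rewrite dot0.
    by have := dotDZr 1 a b v; rewrite scale1r ha hb => ->; ring.
  rewrite -[_ *: _]addr0 dotDZr dot0.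
  by have /rowP/(_ i) := Tv; rewrite !mxE => ->; ring.
have dimf := limg_dim_eq inj.
have full : (f @: s)%VS = fullv.
  by apply/eqP; rewrite eqEdim subvf dimf dimvf /dim/= mul1n.
have : (\row_i phi (vbasis s)`_i : 'rV[R]_(\dim s)) \in (f @: s)%VS.
  by rewrite full memvf.
move=> /memv_imgP[v vs ev]; apply: (none v); split=> //.
apply: decomp => i; move/rowP: ev => /(_ i).
by rewrite fE !mxE => <-.
Qed.

Lemma koszulP (S : lieSubgroup R n) x y :
  nabla S x y \in lie_alg S /\ forall w, w \in lie_alg S ->
    dot (nabla S x y) w =
      (dot (bracket x y) w - dot (bracket y w) x + dot (bracket w x) y) / 2.
Proof.
apply: rieszP => a u v.
rewrite !(bracketN y) !dotNl !bracketDZl !dotDZr !dotDZl; by field.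
Qed.

Lemma nabla_torsion (S : lieSubgroup R n) x y :
  x \in lie_alg S -> y \in lie_alg S ->
  nabla S x y - nabla S y x = bracket x y.
Proof.
move=> xs ys; have [xy1 xy2] := koszulP S x y; have [yx1 yx2] := koszulP S y x.
apply: (@riesz_uniq (lie_alg S)) => [||w ws]; [exact: rpredB|exact: lie_algP|].
rewrite dotBl xy2// yx2//.
by rewrite (bracketN y x) (bracketN w x) (bracketN w y) !dotNl; field.
Qed.

Lemma nabla_metric (S : lieSubgroup R n) x y w :
  y \in lie_alg S -> w \in lie_alg S ->
  dot (nabla S x y) w + dot y (nabla S x w) = 0.
Proof.
move=> ys ws; have [_ xy2] := koszulP S x y; have [_ xw2] := koszulP S x w.
rewrite (dotC y) xy2// xw2//.
by rewrite (bracketN x y) (bracketN w x) (bracketN w y) !dotNl; field.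
Qed.

Lemma is_derive_pair (V W : normedModType R) (f : R -> V) (g : R -> W)
  (t : R) (df : V) (dg : W) :
  is_derive t 1 f df -> is_derive t 1 g dg ->
  is_derive t 1 (fun s => (f s, g s)) (df, dg).
Proof.
move=> [f1 f2] [g1 g2].
have /derivable1_diffP ff := f1; have /derivable1_diffP gg := g1.
have fg : differentiable (fun s => (f s, g s)) t by exact: differentiable_pair.
split; first exact: diff_derivable.
rewrite deriveE// diff_pair//=.
by rewrite -!deriveE// f2 g2.
Qed.

Lemma is_derive_expm1_div (b : R) :
  is_derive (0 : R) 1 (fun t : R => t * expm1_div (t * b)) 1.
Proof.
have [->|b0] := eqVneq b 0.
  rewrite (_ : (fun _ => _) = id); first exact: is_derive_id.
  by apply/funext => t; rewrite mulr0 /expm1_div eqxx mulr1.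
rewrite (_ : (fun _ => _) = (fun t => b^-1 *: (expR (b *: t) - 1))).
  apply: is_derive_eq.
  by rewrite scaler0 expR0 mul1r subr0 -[b%:A]/(b * 1) mulr1 -[LHS]/(b^-1 * b) mulVf.
apply/funext => t /=; rewrite -[RHS]/(b^-1 * (expR (b * t) - 1)) (mulrC b).
by rewrite -expm1_divM mulrC; field.
Qed.

Lemma is_derive_scalel (V : normedModType R) (f : R -> R) (t df : R) (v : V) :
  is_derive t 1 f df -> is_derive t 1 (fun s => f s *: v) (df *: v).
Proof.
move=> [f1 f2]; have /derivable1_diffP ff := f1.
split; first exact/diff_derivable/differentiableZl.
by rewrite deriveE ?diffZl -?deriveE ?f2//; exact: differentiableZl.
Qed.

Lemma is_derive_expAN x : is_derive (0 : R) 1 (fun t : R => expAN (t *: x)) x.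
Proof.
rewrite [X in is_derive _ _ _ X](_ : x = ((x.1.1, x.1.2), x.2)); last first.
  by rewrite -!surjective_pairing.
apply: is_derive_pair; first apply: is_derive_pair.
- rewrite -[X in is_derive _ _ _ X]scale1r.
  exact: (is_derive_scalel (V := R^o)).
- rewrite -[X in is_derive _ _ _ X]scale1r.
  rewrite (_ : (fun _ => _) = fun t : R =>
    (t * expm1_div (t * (x.1.1 / 2))) *: x.1.2).
    exact/is_derive_scalel/is_derive_expm1_div.
  by apply/funext => t /=; rewrite scalerA mulrC -[t *: x.1.1]/(t * _) mulrA.
- rewrite -[X in is_derive _ _ _ X]scale1r.
  rewrite (_ : (fun _ => _) = fun t : R =>
    (t * expm1_div (t * x.1.1)) *: x.2).
    exact/is_derive_scalel/is_derive_expm1_div.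
  apply/funext => t /=; rewrite -[t *: x.1.1]/(t * _) -[t *: x.2]/(t * _).
  by rewrite -[RHS]/(_ * _); ring.
Qed.
End Facts.

(* Main.v *)
Require Import Defs.
From mathcomp Require Import all_boot all_order all_algebra.
From mathcomp Require Import all_classical all_reals all_analysis.
From mathcomp Require Import ring lra.
Import Order.TTheory GRing.Theory Num.Theory.
Local Open Scope classical_set_scope.
Local Open Scope ring_scope.

(** The bracket of any two elements has no B-component, and an element with
    nonzero B-component acts injectively on n; so a nilpotent subalgebra not
    contained in n is abelian, and abelian subgroups are flat.  A non-flat L is
    therefore a nonabelian subgroup of the Heisenberg group N, and its Lie
    algebra contains [n, n] = R Z.  Over an orthonormal basis (x_i) of such an
    algebra, sum_i <nabla_(x_i) x_i, w> = <[w, sum_i <Z, x_i> x_i], Z> =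
    <[w, Z], Z> = 0 for all w in n. *)

Section Bilinear.
Context {R : realType} {n : nat}.
Implicit Types x y w : an R n.
Implicit Types s t : {vspace an R n}.

Lemma dotalpha0l (U : galpha R n) : dotalpha 0 U = 0.
Proof. by have := dotalphaZl 0 0 U; rewrite scale0r mul0r. Qed.

Lemma Jalpha0 : Jalpha 0 = 0 :> galpha R n.
Proof. by have := JalphaZ 0 (0 : galpha R n); rewrite !scale0r. Qed.

Lemma dotDl x y w : dot (x + y) w = dot x w + dot y w.
Proof. by have := dotDZl 1 x y w; rewrite scale1r mul1r. Qed.

Lemma dot0l w : dot 0 w = 0.
Proof. by have := dotZl 0 0 w; rewrite scale0r mul0r. Qed.

Lemma dot_suml (I : Type) (r : seq I) (F : I -> an R n) w :
  dot (\sum_(i <- r) F i) w = \sum_(i <- r) dot (F i) w.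
Proof.
by apply: (big_morph (fun v => dot v w)) => [u v|]; [exact: dotDl|exact: dot0l].
Qed.

Lemma bracketDl x y w : bracket (x + y) w = bracket x w + bracket y w.
Proof. by have := bracketDZl 1 x y w; rewrite !scale1r. Qed.

Lemma bracket0l w : bracket 0 w = 0.
Proof. by apply: (addrI (bracket 0 w)); rewrite -bracketDl !addr0. Qed.

Lemma bracketZl (a : R) x w : bracket (a *: x) w = a *: bracket x w.
Proof. by have := bracketDZl a x 0 w; rewrite bracket0l !addr0. Qed.

Lemma bracket_suml (I : Type) (r : seq I) (F : I -> an R n) w :
  bracket (\sum_(i <- r) F i) w = \sum_(i <- r) bracket (F i) w.
Proof.
apply: (big_morph (fun v => bracket v w)) => [u v|].
- exact: bracketDl.
- exact: bracket0l.
Qed.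

(** [comm_space] is spanned by brackets of basis vectors only; bilinearity extends this to all of
    [s] and [t]. [bracketN] brings the second argument to the left, where [bracket_suml] applies. *)
Lemma bracket_comm_space s t x y :
  x \in s -> y \in t -> bracket x y \in comm_space s t.
Proof.
move=> /coord_vbasis -> yt; rewrite bracket_suml memv_suml// => i _.
rewrite bracketZl memvZ// bracketN memvN {1}(coord_vbasis yt).
rewrite bracket_suml memv_suml// => j _; rewrite bracketZl memvZ//.
rewrite bracketN memvN memv_span//.
by apply: allpairs_f; apply: mem_nth; rewrite size_tuple.
Qed.

Lemma riesz_eq0 s v : v \in s -> (forall w, w \in s -> dot v w = 0) -> v = 0.
Proof. by move=> vs v0; exact/dot_eq0/v0. Qed.

Lemma orth_projP s v :
  orth_proj s v \in s /\ forall w, w \in s -> dot (orth_proj s v) w = dot v w.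
Proof. by apply: rieszP => a u w; rewrite dotDZr. Qed.

End Bilinear.

Section NilpotentSubgroups.
Context {R : realType} {n : nat}.
Implicit Types (x y w : an R n) (L : lieSubgroup R n).

Definition Zvec : an R n := (0, 0, 1).

Lemma dot_Zvec x : dot x Zvec = x.2.
Proof. by rewrite /dot /= dotalphaC dotalpha0l; ring. Qed.

(** Every term of the Koszul formula contains a bracket of two elements of the algebra, so the
    connection itself vanishes. *)
Lemma abelian_flat L :
  (forall x y, x \in lie_alg L -> y \in lie_alg L -> bracket x y = 0) -> flat L.
Proof.
move=> ab.
have nab0 x y : x \in lie_alg L -> y \in lie_alg L -> nabla L x y = 0.
  move=> xL yL; have [nL nE] := koszulP L x y.
  by apply: (riesz_eq0 _ _ nL) => w wL; rewrite nE// !ab// !dot0l; lra.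
move=> x y w xL yL wL.
by rewrite /curvature ab// !nab0 ?mem0v// !subrr.
Qed.

(** With b the B-component of [x], [ad x] is triangular on n, with eigenvalues b/2 on g_alpha and b
    on R Z. The g_alpha equation is solved first, since it kills the cross term in the Z
    equation. *)
Lemma ad_inj_nalg x y : x.1.1 != 0 -> y.1.1 = 0 -> bracket x y = 0 -> y = 0.
Proof.
move=> x0 y0 /[dup] /(congr1 (fun v => v.1.2)) /= + /(congr1 snd) /=.
rewrite y0 !mul0r scale0r !subr0 => /eqP.
rewrite scaler_eq0 mulf_eq0 invr_eq0 (negbTE x0) pnatr_eq0 /= => /eqP U0.
rewrite U0 [dotalpha _ 0]dotalphaC dotalpha0l addr0.
move=> /eqP; rewrite mulf_eq0 (negbTE x0) /= => /eqP z0.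
exact: an_eq.
Qed.

Lemma nilpotent_sub_nalg (l : {vspace an R n}) x y :
  nilpotent_alg l -> x \in l -> y \in l -> x.1.1 != 0 -> y.1.1 = 0 -> y = 0.
Proof.
move=> [k lk] xl yl x0 y0; apply: contrapT => yN0.
(* Iterating [ad x] on [y] gives a nonzero vector of n in every term of the lower central series. *)
have : exists v, [/\ v \in lower_central l k, v.1.1 = 0 & v <> 0].
  elim: k {lk} => [|k [v [vl v0 vN0]]]; first by exists y.
  exists (bracket x v); split=> //; first exact: bracket_comm_space.
  by move=> /ad_inj_nalg => /(_ x0 v0).
by rewrite lk => -[v [/[!memv0] /eqP]].
Qed.

Lemma nonflat_sub_nalg L :
  nilpotent_alg (lie_alg L) -> ~ flat L -> (lie_alg L <= n_alg R n)%VS.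
Proof.
move=> nilL nflat; apply/subvP => x xL; rewrite n_algE.
apply: contrapT => /negP x0; apply/nflat/abelian_flat => y w yL wL.
by apply: (nilpotent_sub_nalg _ x (bracket y w) nilL) => //; exact: lie_algP.
Qed.

(** By [abelian_flat] some bracket is nonzero; inside n it is a multiple of Z, so it can be rescaled
    to Z. *)
Lemma nonabelian_Z L :
  (lie_alg L <= n_alg R n)%VS -> ~ flat L -> Zvec \in lie_alg L.
Proof.
move=> /subvP LN nflat; apply: contrapT => ZL.
apply/nflat/abelian_flat => x y xL yL.
have /eqP x0 : x.1.1 == 0 by rewrite -n_algE LN.
have /eqP y0 : y.1.1 == 0 by rewrite -n_algE LN.
have bE : bracket x y = (bracket x y).2 *: Zvec.
  apply: an_eq => /=; first by rewrite scaler0.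
  - by rewrite x0 y0 !mul0r !scale0r subrr scaler0.
  - by rewrite -[RHS]/(_ * _) mulr1.
have [z0|zN0] := eqVneq (bracket x y).2 0; first by rewrite bE z0 scale0r.
exfalso; apply: ZL.
have -> : Zvec = (bracket x y).2^-1 *: bracket x y.
  by rewrite [X in _ *: X]bE scalerA mulVf// scale1r.
by rewrite memvZ// lie_algP.
Qed.

(** The difference of the two sides lies in [s] and is orthogonal to each basis vector, hence to
    itself. *)
Lemma orthonormal_sum (s : {vspace an R n}) (e : seq (an R n)) v :
  orthonormal_basis s e -> v \in s -> \sum_(x <- e) dot v x *: x = v.
Proof.
move=> [be oe] vs; apply/esym/eqP; rewrite -subr_eq0; apply/eqP/(riesz_eq0 s).
  rewrite rpredB// big_seq memv_suml// => x xe.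
  by rewrite memvZ// (basis_mem be).
have ve x : x \in e -> dot (v - \sum_(x <- e) dot v x *: x) x = 0.
  move=> xe; have ixe : (index x e < size e)%N by rewrite index_mem.
  rewrite dotBl dot_suml (big_nth 0) big_mkord (bigD1 (Ordinal ixe))//=.
  rewrite big1 => [|i ni].
    have := oe _ _ ixe ixe; rewrite dotZl nth_index// eqxx => ->.
    by rewrite mulr1 addr0 subrr.
  have := oe _ _ (ltn_ord i) ixe; rewrite nth_index// dotZl => ->.
  by rewrite (_ : _ == _ = false) ?mulr0//; exact/negbTE.
move=> w; rewrite -(span_basis be) => we.
have wE := coord_span (X := in_tuple e) we.
rewrite dotC wE dot_suml big1// => i _.
by rewrite dotZl dotC ve ?mulr0// mem_nth.
Qed.

Lemma minimal_of_Z L :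
  (lie_alg L <= n_alg R n)%VS -> Zvec \in lie_alg L ->
  minimal_submanifold (N R n) L.
Proof.
move=> /subvP LN ZL; split.
  (* A subgroup containing exp(n) contains the exponentials of the smaller algebra, hence the group
     they generate. *)
  move=> p pL A [subA NA]; apply: pL; split=> // _ [x /LN xN <-].
  by apply: NA; exists x.
move=> e oe; have [be _] := oe.
have eN x : x \in e -> x.1.1 = 0.
  by move=> xe; apply/eqP; rewrite -n_algE LN// (basis_mem be).
have H0 : \sum_(x <- e) nabla (N R n) x x = 0.
  apply: (@riesz_eq0 _ _ (n_alg R n)) => [|w wN].
    by rewrite memv_suml// => x _; have [] := koszulP (N R n) x x.
  have /eqP w0 : w.1.1 == 0 by rewrite -n_algE.
  (* Koszul reduces each term to - <[x, w], x>. Since [x, w] is a multiple of Z, this is - <Z, x>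
     <[x, w], Z>, and the scalar moves inside the bracket. *)
  have -> : dot (\sum_(x <- e) nabla (N R n) x x) w =
            - dot (bracket (\sum_(x <- e) dot Zvec x *: x) w) Zvec.
    rewrite dot_suml bracket_suml dot_suml -sumrN.
    apply: eq_big_seq => x /eN x0.
    have [_ ->//] := koszulP (N R n) x x.
    rewrite bracketZl dotZl dot_Zvec (dotC Zvec) dot_Zvec (bracketN w x) (bracketN x x).
    rewrite !dotNl.
    have -> : dot (bracket x x) w = 0.
      have -> : bracket x x = 0; last exact: dot0l.
      by apply: an_eq; rewrite //= ?subrr// dotalphaJJ addr0.
    rewrite /dot /= x0 w0 !mul0r !scale0r subrr.
    rewrite dotalpha0l; lra.
  (* The sum inside the bracket is Z, which is central in n. *)
  rewrite (orthonormal_sum (lie_alg L))// /dot /bracket /= w0 !mul0r !scale0r subrr.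
  by rewrite Jalpha0 !dotalpha0l; lra.
(* What remains is the sum of the tangential parts; paired with vectors of [lie_alg L] it agrees
   with the vanishing sum of [nabla]. *)
rewrite /second_form sumrB H0 sub0r; apply/eqP; rewrite oppr_eq0; apply/eqP.
apply: (@riesz_eq0 _ _ (lie_alg L)) => [|w wL].
  by rewrite memv_suml// => x _; have [] := orth_projP (lie_alg L) (nabla (N R n) x x).
transitivity (dot (\sum_(x <- e) nabla (N R n) x x) w); last by rewrite H0 dot0l.
rewrite !dot_suml; apply: eq_bigr => x _.
by have [_ ->] := orth_projP (lie_alg L) (nabla (N R n) x x).
Qed.

End NilpotentSubgroups.

Theorem corollary1p6 (R : realType) (n : nat) (hn : (1 <= n)%N)
  (S : lieSubgroup R n) (hproper : carrier S <> setT)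
  (hS : ricci_soliton S)
  (L : lieSubgroup R n) (hL : is_nilradical S L) (hnonflat : ~ flat L) :
  minimal_submanifold (N R n) L.
Proof.
have [[_ _ nilL] _] := hL; have LN := nonflat_sub_nalg L nilL hnonflat.
exact: (minimal_of_Z L LN (nonabelian_Z L LN hnonflat)).
Qed.
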